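(* Let $K$ be a field with a non-trivial non-Archimedean absolute value, with valuation $v:K^\times\to\mathbb{R}$ (so $|x|=e^{-v(x)}$), $v(0)=\infty$, and ring of integers $\mathcal{O}_K=\{x\in K:|x|\le 1\}$. Let $n\ge 2$ and let $x=\sum_{i=1}^n x_i\eta_i$ (with $x_i\in\mathbb{R}$, $\sum_i x_i=0$) be a point of the standard apartment $A$ of the Bruhat–Tits building $\mathfrak{B}(SL_n,K)$, and let $P_x\subseteq SL_n(K)$ be the stabilizer of $x$ for the action of $SL_n(K)$ on $\mathfrak{B}(SL_n,K)$. Then \[P_x=\{g\in SL_n(K):\ g_{\mathrm{trop}}\cdot {}^t(x_1,\dots,x_n)={}^t(x_1,\dots,x_n)\},\] where for $g=(g_{ij})$ the tropical product is defined by $\big(g_{\mathrm{trop}}\cdot {}^t(x_1,\dots,x_n)\big)_i=\max_j\{-v(g_{ij})+x_j\}$ (terms with $g_{ij}=0$ being $-\infty$), and the equality is equality of vectors in $\mathbb{R}^n$.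
   Context: Setup of the building. Let $e_1,\dots,e_n$ be the standard basis of $K^n$, $T\subset SL_n$ the diagonal torus, $a_i\in X^*(T)$ the character $\mathrm{diag}(s_1,\dots,s_n)\mapsto s_i$, and $\eta_i$ the cocharacter of $GL_n$ sending $s$ to the diagonal matrix with $s$ in position $i$ and $1$ elsewhere; the pairing satisfies $a_i(\eta_j)=\delta_{ij}$. The apartment is $A=\{\sum_i x_i\eta_i: x_i\in\mathbb{R},\ \sum_i x_i=0\}$. Let $N$ be the normalizer of $T$ in $SL_n$; each $m\in N(K)$ satisfies $m(e_i)=t_ie_{\sigma(i)}$ for some permutation $\sigma$ and $t_i\in K^\times$; the torus $T(K)$ acts on $A$ by translation $\mathrm{diag}(t_1,\dots,t_n)\cdot x=x+\sum_i(-v(t_i))\eta_i$ and the Weyl group $N(K)/T(K)\cong\mathcal{S}_n$ acts by permuting coordinates, giving an affine action $x\mapsto \nu(m)x$ of $N(K)$ on $A$. The roots are $a_{ij}=a_i/a_j$ ($i\neq j$), with root group $U_{a_{ij}}$ consisting of the elementary matrices $u$ with $u(e_k)=e_k$ for $k\neq j$ and $u(e_j)=e_j+\omega e_i$, $\omega\in K$; for $l\in\mathbb{R}$ put $U_{a,l}=\{u\in U_a(K): v(\omega)\ge l\}$. For $x\in A$ let $U_x$ be the group generated by all $U_{a,-a(x)}$ ($a$ a root, $a_{ij}(x)=x_i-x_j$), $N_x$ the stabilizer of $x$ in $N(K)$, and $P_x=N_xU_x$. The building $\mathfrak{B}(SL_n,K)$ is the quotient of $SL_n(K)\times A$ by the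 relation $(g,x)\sim(h,y)$ iff there is $m\in N(K)$ with $\nu(m)x=y$ and $g^{-1}hm\in P_x$, with $SL_n(K)$ acting by left multiplication on the first factor; $A$ embeds via $x\mapsto[(1,x)]$, and $P_x$ is the stabilizer of $x$. *)

(* Defs.v *)
From HB Require Import structures.
From mathcomp Require Import all_boot all_order all_algebra.
From mathcomp Require Import perm generic_quotient.
From mathcomp Require Import boolp classical_sets reals constructive_ereal.
From mathcomp Require Import ereal exp.

Set Implicit Arguments.
Unset Strict Implicit.
Unset Printing Implicit Defensive.

Import Order.TTheory GRing.Theory Num.Theory.
Local Open Scope classical_set_scope.
Local Open Scope quotient_scope.
Local Open Scope ring_scope.

Record nonarch_abs (R : realType) (K : fieldType) := NonarchAbs {
  absv :> K -> R;
  absv_ge0 : forall a, 0 <= absv a;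
  absv_eq0 : forall a, absv a = 0 <-> a = 0;
  absvM : forall a b, absv (a * b) = absv a * absv b;
  absv_ultra : forall a b, absv (a + b) <= Num.max (absv a) (absv b);
  absv_nontrivial : exists a, a <> 0 /\ absv a <> 1 }.

(* The additive valuation, i.e. |a| = e ^ (- v a), with v 0 = +oo. *)
Definition val_of (R : realType) (K : fieldType) (abs : nonarch_abs R K)
    (a : K) : \bar R :=
  if a == 0 then +oo%E else (- ln (abs a))%:E.

Record SL (K : fieldType) (n : nat) :=
  MkSL { slmx :> 'M[K]_n; slmx_det : \det slmx == 1 }.

HB.instance Definition _ (K : fieldType) (n : nat) :=
  [isSub for @slmx K n].
HB.instance Definition _ (K : fieldType) (n : nat) :=
  [Choice of SL K n by <:].

Lemma sl1_det (K : fieldType) n : \det (1%:M : 'M[K]_n) == 1.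
Proof. by rewrite det1. Qed.

Lemma slM_det (K : fieldType) n (g h : SL K n) : \det (g *m h) == 1.
Proof. by rewrite det_mulmx (eqP (slmx_det g)) (eqP (slmx_det h)) mulr1. Qed.

Lemma slV_det (K : fieldType) n (g : SL K n) : \det (invmx g) == 1.
Proof. by rewrite det_inv (eqP (slmx_det g)) invr1. Qed.

Lemma sl_unit (K : fieldType) n (g : SL K n) : slmx g \in unitmx.
Proof. by rewrite unitmxE (eqP (slmx_det g)) unitr1. Qed.

Definition sl_one (K : fieldType) n : SL K n := MkSL (sl1_det K n).
Definition sl_mul (K : fieldType) n (g h : SL K n) : SL K n :=
  MkSL (slM_det g h).
Definition sl_inv (K : fieldType) n (g : SL K n) : SL K n :=
  MkSL (slV_det g).

Lemma sl_mulA (K : fieldType) n : associative (@sl_mul K n).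
Proof. by move=> f g h; apply/val_inj; rewrite /= mulmxA. Qed.
Lemma sl_mul1 (K : fieldType) n : left_id (sl_one K n) (@sl_mul K n).
Proof. by move=> g; apply/val_inj; rewrite /= mul1mx. Qed.
Lemma sl_mulr1 (K : fieldType) n : right_id (sl_one K n) (@sl_mul K n).
Proof. by move=> g; apply/val_inj; rewrite /= mulmx1. Qed.
Lemma sl_mulV (K : fieldType) n :
  left_inverse (sl_one K n) (@sl_inv K n) (@sl_mul K n).
Proof. by move=> g; apply/val_inj; rewrite /= mulVmx ?sl_unit. Qed.
Lemma sl_mulrV (K : fieldType) n :
  right_inverse (sl_one K n) (@sl_inv K n) (@sl_mul K n).
Proof. by move=> g; apply/val_inj; rewrite /= mulmxV ?sl_unit. Qed.

HB.instance Definition _ (K : fieldType) (n : nat) :=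
  isGroup.Build (SL K n) (@sl_mulA K n) (@sl_mul1 K n) (@sl_mulr1 K n)
    (@sl_mulV K n) (@sl_mulrV K n).

Lemma slmxM (K : fieldType) n (g h : SL K n) :
  slmx (g * h)%g = slmx g *m slmx h.
Proof. by []. Qed.

Lemma slmx1 (K : fieldType) n : slmx (1%g : SL K n) = 1%:M.
Proof. by []. Qed.

(* Coordinates with respect to the cocharacters eta_1, ..., eta_n. *)
Record apartment (R : realType) (n : nat) :=
  Apartment { aptv :> 'cV[R]_n; aptv_sum : \sum_i aptv i 0 == 0 }.

HB.instance Definition _ (R : realType) (n : nat) :=
  [isSub for @aptv R n].
HB.instance Definition _ (R : realType) (n : nat) :=
  [Choice of apartment R n by <:].

Definition torus (K : fieldType) (n : nat) : set (SL K n) :=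
  [set t | is_diag_mx (slmx t)].

(* K is infinite because its absolute value is non-trivial, so T(K) is Zariski
   dense in T, and N(K) is the normalizer of T(K) in SL_n(K). *)
Definition normT (K : fieldType) (n : nat) : set (SL K n) :=
  [set m | [set (m * t * m^-1)%g | t in @torus K n] = @torus K n].

(* The permutation s such that m(e_i) = t_i e_(s i) with t_i != 0 for all i;
   it exists for m in normT (lemma normT_monomial), and the value 1 taken on
   other matrices is irrelevant. *)
Definition mono_perm (K : fieldType) (n : nat) (m : 'M[K]_n) : 'S_n :=
  odflt 1%g [pick s : 'S_n | [forall i, forall k, (m k i != 0) == (k == s i)]].

(* nu(m) permutes the coordinates by s (eta_i |-> eta_(s i)), then translates
   by the diagonal matrix whose entry in position s i is t_i = m (s i) i. *)
Definition nu (R : realType) (K : fieldType) (abs : nonarch_abs R K) (n : nat)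
    (m : SL K n) (x : 'cV[R]_n) : 'cV[R]_n :=
  let s := mono_perm m in
  \sum_i x i 0 *: delta_mx (s i) 0
    + \sum_i (- fine (val_of abs (m (s i) i))) *: delta_mx (s i) 0.

Definition root_subgroup (R : realType) (K : fieldType)
    (abs : nonarch_abs R K) (n : nat) (i j : 'I_n) (l : R) : set (SL K n) :=
  [set u | exists2 w : K, (l%:E <= val_of abs w)%E
                        & slmx u = 1%:M + w *: delta_mx i j].

Definition is_subgroup (G : groupType) (H : set G) : Prop :=
  H 1%g /\ forall g h, H g -> H h -> H (g * h^-1)%g.

Definition U_at (R : realType) (K : fieldType) (abs : nonarch_abs R K)
    (n : nat) (x : 'cV[R]_n) : set (SL K n) :=
  smallest (@is_subgroup (SL K n))
    [set u | exists i j : 'I_n,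
       i != j /\ root_subgroup abs i j (- (x i 0 - x j 0)) u].

Definition N_at (R : realType) (K : fieldType) (abs : nonarch_abs R K)
    (n : nat) (x : 'cV[R]_n) : set (SL K n) :=
  [set m | @normT K n m /\ nu abs m x = x].

Definition P_at (R : realType) (K : fieldType) (abs : nonarch_abs R K)
    (n : nat) (x : 'cV[R]_n) : set (SL K n) :=
  [set (m * u)%g | m in N_at abs x & u in U_at abs x].

Definition bt_rel (R : realType) (K : fieldType) (abs : nonarch_abs R K)
    (n : nat) (p q : SL K n * apartment R n) : Prop :=
  exists m : SL K n,
    [/\ normT m, nu abs m p.2 = q.2 & P_at abs p.2 (p.1^-1 * q.1 * m)%g].

Lemma absv1 (R : realType) (K : fieldType) (abs : nonarch_abs R K) :
  abs 1 = 1.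
Proof.
have n0 : abs 1 != 0.
  by apply/eqP => /absv_eq0/eqP; rewrite oner_eq0.
by apply: (mulfI n0); rewrite -absvM !mulr1.
Qed.

Lemma absv_gt0 (R : realType) (K : fieldType) (abs : nonarch_abs R K) a :
  a != 0 -> 0 < abs a.
Proof.
move=> a0; rewrite lt_neqAle absv_ge0 andbT eq_sym.
by apply/eqP => /absv_eq0/eqP; rewrite (negPf a0).
Qed.

Lemma val_ofM (R : realType) (K : fieldType) (abs : nonarch_abs R K) a b :
  val_of abs (a * b) = (val_of abs a + val_of abs b)%E.
Proof.
rewrite /val_of mulf_eq0; case: eqVneq => a0 //=; case: eqVneq => b0 //=.
by rewrite absvM lnM ?posrE ?absv_gt0 // opprD.
Qed.

Lemma val_ofE (R : realType) (K : fieldType) (abs : nonarch_abs R K) a :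
  a != 0 -> val_of abs a = (fine (val_of abs a))%:E.
Proof. by rewrite /val_of; case: eqVneq. Qed.

Lemma fine_val1 (R : realType) (K : fieldType) (abs : nonarch_abs R K) :
  fine (val_of abs 1) = 0.
Proof. by rewrite /val_of oner_eq0 /= absv1 ln1 oppr0. Qed.

Lemma fine_valM (R : realType) (K : fieldType) (abs : nonarch_abs R K) a b :
  a != 0 -> b != 0 ->
  fine (val_of abs (a * b)) = fine (val_of abs a) + fine (val_of abs b).
Proof.
by move=> a0 b0; rewrite val_ofM (val_ofE abs a0) (val_ofE abs b0).
Qed.

Lemma ex_sqr_neq1 (R : realType) (K : fieldType) (abs : nonarch_abs R K) :
  exists c : K, c != 0 /\ c * c != 1.
Proof.
have [c [/eqP c0 c1]] := absv_nontrivial abs; exists c; split=> //.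
apply/eqP => /(congr1 abs); rewrite absvM absv1 => /eqP.
rewrite -expr2 sqrf_eq1 => /orP[/eqP//|/eqP cN].
by have := absv_ge0 abs c; rewrite cN lerNr oppr0 ler10.
Qed.

Lemma ex_torus (K : fieldType) n (c : K) (i j : 'I_n) : c != 0 -> i != j ->
  exists t : SL K n, [/\ torus t, t i i = c & t j j = c^-1].
Proof.
move=> c0 ij.
pose d := \row_k (if k == i then c else if k == j then c^-1 else 1).
have dt : \det (diag_mx d) == 1.
  rewrite det_diag (bigD1 i) //= (bigD1 j) 1?eq_sym //= !mxE eqxx.
  rewrite (eq_sym j) (negPf ij) eqxx big1 ?mulr1 ?divff // => k /andP[ki kj].
  by rewrite mxE (negPf ki) (negPf kj).
exists (MkSL dt); split; first by rewrite /torus /= diag_mx_is_diag.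
- by rewrite /= !mxE !eqxx.
- by rewrite /= !mxE !eqxx (eq_sym j) (negPf ij).
Qed.

Definition monomial (K : fieldType) n (m : 'M[K]_n) (s : 'S_n) : Prop :=
  forall i k, (m k i != 0) = (k == s i).

Lemma normT_monomial (R : realType) (K : fieldType) (abs : nonarch_abs R K) n
  (m : SL K n) : normT m -> exists s : 'S_n, monomial m s.
Proof.
move=> mN.
have row1 i j k : m k i != 0 -> m k j != 0 -> i = j.
  move=> mi mj; apply/eqP/negPn/negP => ij.
  have [c [c0 c1]] := ex_sqr_neq1 abs.
  have [t [tT ti tj]] := ex_torus c0 ij.
  have [t' t'T E] : exists2 t' : SL K n, torus t' &
      slmx m *m slmx t = slmx t' *m slmx m.
    exists (m * t * m^-1)%g; first by rewrite -mN; exists t.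
    by rewrite -!slmxM mulgVK.
  have Ek l : m k l * t l l = t' k k * m k l.
    have /matrixP/(_ k l) := E; rewrite !mxE (bigD1 l) //= big1; last first.
      by move=> p pl; rewrite (is_diag_mxP tT) ?mulr0.
    rewrite (bigD1 k) //= big1; last first.
      by move=> p pk; rewrite (is_diag_mxP t'T) ?mul0r // eq_sym.
    by move=> e; rewrite !addr0 in e.
  have e1 : c = t' k k by apply: (mulfI mi); rewrite -ti Ek mulrC.
  have e2 : c^-1 = t' k k by apply: (mulfI mj); rewrite -tj Ek mulrC.
  by case/eqP: c1; rewrite {2}e1 -e2 divff.
have col1 i : exists k, m k i != 0.
  apply/existsP; apply: contraT; rewrite negb_exists => /forallP m0.
  have := slmx_det m; rewrite (expand_det_col m i) big1 1?eq_sym ?oner_eq0 //.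
  by move=> k _; have := m0 k; rewrite negbK => /eqP->; rewrite mul0r.
pose f i := xchoose (col1 i).
have fP i : m (f i) i != 0 by exact: xchooseP (col1 i).
have fI : injective f.
  by move=> i j fij; apply: (row1 _ _ (f i)); rewrite ?fP // fij fP.
exists (perm fI) => i k; rewrite permE; apply/idP/eqP => [mki|->//].
have kE : k = f ((perm fI)^-1%g k) by rewrite -[f _](permE fI) permKV.
by rewrite kE; congr f; apply: (row1 _ _ k) => //; rewrite {1}kE fP.
Qed.

Lemma mono_permE (K : fieldType) n (m : 'M[K]_n) s :
  monomial m s -> mono_perm m = s.
Proof.
move=> ms; rewrite /mono_perm; case: pickP => [s' /forallP s'P|/(_ s)] /=.
  apply/permP => i; apply/eqP; rewrite -ms.
  by have /forallP/(_ (s' i))/eqP-> := s'P i.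
by move=> /negP[]; apply/forallP => i; apply/forallP => k; rewrite ms.
Qed.

Lemma nuE (R : realType) (K : fieldType) (abs : nonarch_abs R K) n
  (m : SL K n) s x i : monomial m s ->
  nu abs m x (s i) 0 = x i 0 - fine (val_of abs (m (s i) i)).
Proof.
move=> ms; rewrite /nu (mono_permE ms) -big_split /= summxE (bigD1 i) //=.
rewrite !mxE !eqxx !mulr1 big1 ?addr0 // => j ji.
by rewrite !mxE (inj_eq perm_inj) eq_sym (negPf ji) !mulr0 addr0.
Qed.

Lemma monomial1 (K : fieldType) n : monomial (1%:M : 'M[K]_n) 1.
Proof. by move=> i k; rewrite !mxE perm1; case: (k == i); rewrite ?oner_eq0 ?eqxx. Qed.

Lemma monomialM_entry (K : fieldType) n (m m' : 'M[K]_n) s s' i k :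
  monomial m s -> monomial m' s' ->
  (m *m m') k i = m k (s' i) * m' (s' i) i.
Proof.
move=> ms ms'; rewrite mxE (bigD1 (s' i)) //= big1 ?addr0 // => j ji.
by have /eqP-> : m' j i == 0; rewrite ?mulr0 // -[_ == _]negbK ms' ji.
Qed.

Lemma monomialM (K : fieldType) n (m m' : 'M[K]_n) s s' :
  monomial m s -> monomial m' s' -> monomial (m *m m') (s' * s)%g.
Proof.
move=> ms ms' i k; rewrite (monomialM_entry _ _ ms ms') mulf_eq0 negb_or.
by rewrite ms ms' eqxx andbT permM.
Qed.

Lemma nu1 (R : realType) (K : fieldType) (abs : nonarch_abs R K) n x :
  nu abs (1%g : SL K n) x = x.
Proof.
apply/colP => i; have := nuE abs (m := 1%g) x i (@monomial1 K n).
by rewrite perm1 => ->; rewrite slmx1 mxE eqxx fine_val1 subr0.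
Qed.

Lemma nuM (R : realType) (K : fieldType) (abs : nonarch_abs R K) n
  (m m' : SL K n) x : normT m -> normT m' ->
  nu abs (m * m')%g x = nu abs m (nu abs m' x).
Proof.
move=> /(normT_monomial abs)[s ms] /(normT_monomial abs)[s' ms'].
apply/colP => k; have [i ->] : exists i, k = (s' * s)%g i.
  by exists ((s' * s)^-1%g k); rewrite permKV.
rewrite (nuE abs (m := (m * m')%g) _ _ (monomialM ms ms')) slmxM.
rewrite (monomialM_entry _ _ ms ms') permM !nuE // fine_valM ?ms ?ms' //.
by rewrite opprD addrA addrAC.
Qed.

(* T(K) acts by translations. *)
Lemma nu_torus (R : realType) (K : fieldType) (abs : nonarch_abs R K) n
  (t : SL K n) x : torus t ->
  nu abs t x = x + \sum_i (- fine (val_of abs (t i i))) *: delta_mx i 0.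
Proof.
move=> tT; have t0 i : t i i != 0.
  have := sl_unit t; have /is_diag_mxP tD := tT.
  rewrite unitmxE (expand_det_row t i) unitfE; apply: contra => /eqP ti.
  rewrite big1 // => j _; case: (eqVneq i j) => [<-|ij].
    by rewrite ti mul0r.
  by rewrite tD ?mul0r.
have tm : monomial t 1.
  move=> i k; rewrite perm1; case: (eqVneq k i) => [->|ki]; first by rewrite t0.
  by rewrite (is_diag_mxP tT k i ki) eqxx.
apply/colP => i; have := nuE abs x i tm; rewrite perm1 => ->.
rewrite mxE summxE (bigD1 i) //= !mxE !eqxx mulr1 big1 ?addr0 // => j ji.
by rewrite !mxE eq_sym (negPf ji) mulr0.
Qed.

Lemma torus_conj (K : fieldType) n (m t : SL K n) :
  normT m -> torus t -> torus (m * t * m^-1)%g.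
Proof. by move=> mN tT; rewrite -mN; exists t. Qed.

Lemma torus_conjV (K : fieldType) n (m t : SL K n) :
  normT m -> torus t -> torus (m^-1 * t * m)%g.
Proof.
by move=> mN; rewrite -{1}mN => -[t' t'T <-]; rewrite !mulgA mulVg mul1g mulgVK.
Qed.

Lemma normT1 (K : fieldType) n : normT (1%g : SL K n).
Proof.
apply/seteqP; split=> [_ [t tT <-]|t tT]; first by rewrite invg1 mulg1 mul1g.
by exists t => //; rewrite invg1 mulg1 mul1g.
Qed.

Lemma normTV (K : fieldType) n (m : SL K n) : normT m -> normT m^-1%g.
Proof.
move=> mN; apply/seteqP; split=> [_ [t tT <-]|t tT].
  by rewrite invgK; exact: torus_conjV.
exists (m * t * m^-1)%g; first exact: torus_conj.
by rewrite invgK !mulgA mulVg mul1g mulgVK.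
Qed.

Lemma normTM (K : fieldType) n (m m' : SL K n) :
  normT m -> normT m' -> normT (m * m')%g.
Proof.
move=> mN m'N; apply/seteqP; split=> [_ [t tT <-]|t tT].
  have := torus_conj mN (torus_conj m'N tT).
  by rewrite invgM !mulgA.
exists (m'^-1 * (m^-1 * t * m) * m')%g.
  exact/torus_conjV/torus_conjV.
by rewrite invgM !mulgA !mulgK mulgV mul1g.
Qed.

Lemma nuK (R : realType) (K : fieldType) (abs : nonarch_abs R K) n
  (m : SL K n) x : normT m -> nu abs m^-1%g (nu abs m x) = x.
Proof. by move=> mN; rewrite -nuM ?mulVg ?nu1 //; exact: normTV. Qed.

Lemma U_at_subgroup (R : realType) (K : fieldType) (abs : nonarch_abs R K) n
  (x : 'cV[R]_n) : is_subgroup (U_at abs x).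
Proof.
split=> [H [[]]//|g h gU hU H [HG HS]].
by apply: (proj2 HG); [exact: gU|exact: hU].
Qed.

Lemma subgroupM (G : groupType) (H : set G) g h :
  is_subgroup H -> H g -> H h -> H (g * h)%g.
Proof.
move=> [H1 Hdiv] gH hH; rewrite -[h]invgK; apply: (Hdiv) => //.
by rewrite -[h^-1%g]mul1g; exact: Hdiv.
Qed.

Lemma subgroupV (G : groupType) (H : set G) g :
  is_subgroup H -> H g -> H g^-1%g.
Proof. by move=> [H1 Hdiv] gH; rewrite -[g^-1%g]mul1g; exact: Hdiv. Qed.

Lemma U_at_conj (R : realType) (K : fieldType) (abs : nonarch_abs R K) n
  (m u : SL K n) x : normT m -> U_at abs x u ->
  U_at abs (nu abs m x) (m * u * m^-1)%g.
Proof.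
move=> mN uU.
pose H := [set g : SL K n | U_at abs (nu abs m x) (m * g * m^-1)%g].
have US := U_at_subgroup abs (nu abs m x).
suff : H u by [].
apply: uU; split.
  split; first by rewrite /H /= mulg1 mulgV; exact: (proj1 US).
  move=> g h gH hH; rewrite /H /=.
  suff -> : (m * (g * h^-1) * m^-1 = m * g * m^-1 * (m * h * m^-1)^-1)%g.
    exact: (proj2 US).
  by rewrite !invgM invgK !mulgA mulgVK.
move=> g [i [j [ij [w wl gE]]]]; rewrite /H /=.
have [s ms] := normT_monomial abs mN.
move=> G [GG]; apply; exists (s i), (s j); rewrite (inj_eq perm_inj).
split=> //; pose ti := m (s i) i; pose tj := m (s j) j.
have ti0 : ti != 0 by rewrite ms.
have tj0 : tj != 0 by rewrite ms.
exists (w * ti / tj).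
  rewrite !(nuE abs _ _ ms) -/ti -/tj.
  have -> : - (x i 0 - fine (val_of abs ti) - (x j 0 - fine (val_of abs tj)))
     = - (x i 0 - x j 0) + fine (val_of abs ti) + fine (val_of abs tj^-1).
    have : fine (val_of abs (tj * tj^-1)) = 0 by rewrite divff ?fine_val1.
    rewrite fine_valM ?invr_eq0 // addrC => /eqP; rewrite addr_eq0 => /eqP->.
    by rewrite !opprD !opprK addrACA addrA.
  rewrite !val_ofM !EFinD -!val_ofE ?invr_eq0 //.
  by rewrite !leeD2r.
have mE k p : m k p = m k p *+ (k == s p).
  have := ms p k; case: (eqVneq k (s p)) => [_ _|_ /negbFE/eqP->] //; rewrite mul0rn.
have E : slmx m *m slmx g =
    (1%:M + (w * ti / tj) *: delta_mx (s i) (s j)) *m slmx m.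
  rewrite gE mulmxDr mulmxDl mulmx1 mul1mx -scalemxAl -scalemxAr; congr +%R.
  apply/matrixP => k p; rewrite !mxE (bigD1 i) //= big1 ?addr0; last first.
    by move=> q qi; rewrite !mxE (negPf qi) mulr0.
  rewrite (bigD1 (s j)) //= big1 ?addr0; last first.
    by move=> q qj; rewrite !mxE (negPf qj) andbF mul0r.
  rewrite !mxE !eqxx andbT /= (mE k i) (mE (s j) p) (inj_eq perm_inj).
  rewrite (eq_sym j p); case: (eqVneq p j) => [->|_]; last first.
    by rewrite !mulr0n !mulr0.
  case: (eqVneq k (s i)) => [->|_]; rewrite /= ?mulr0n ?mulr1n ?mul0r ?mulr0 //.
  by rewrite mulr1 mul1r -/ti -/tj mulfVK.
rewrite !slmxM E -mulmxA.
by rewrite -[X in _ *m X]slmxM mulgV slmx1 mulmx1.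
Qed.

Lemma N_at_subgroup (R : realType) (K : fieldType) (abs : nonarch_abs R K) n
  (x : 'cV[R]_n) : is_subgroup (@N_at R K abs n x).
Proof.
split=> [|g h [gN gx] [hN hx]]; first by split; [exact: normT1|exact: nu1].
have hx' : nu abs h^-1%g x = x by rewrite -{1}hx nuK.
by split; [exact/normTM/normTV|rewrite nuM ?hx' //; exact: normTV].
Qed.

Lemma P_at_subgroup (R : realType) (K : fieldType) (abs : nonarch_abs R K) n
  (x : 'cV[R]_n) : is_subgroup (@P_at R K abs n x).
Proof.
have NS := N_at_subgroup abs x; have US := U_at_subgroup abs x.
split; first by exists 1%g; [exact: NS.1|exists 1%g; rewrite ?mulg1 //; exact: US.1].
move=> _ _ [m mN [u uU <-]] [m' m'N [u' u'U <-]].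
exists (m * m'^-1)%g; first exact: NS.2.
exists (m' * (u * u'^-1) * m'^-1)%g; last by rewrite !invgM !mulgA mulgVK.
by rewrite -[X in U_at abs X](m'N.2); apply: U_at_conj; [exact: m'N.1|exact: US.2].
Qed.

Lemma P_at_conj (R : realType) (K : fieldType) (abs : nonarch_abs R K) n
  (m g : SL K n) x : normT m -> P_at abs x g ->
  P_at abs (nu abs m x) (m * g * m^-1)%g.
Proof.
move=> mN [m' [m'N m'x] [u uU <-]].
exists (m * m' * m^-1)%g.
  split; first exact/normTM/normTV/mN/normTM.
  by rewrite !nuM ?nuK ?m'x //; [exact: normTM|exact: normTV].
by exists (m * u * m^-1)%g; [exact: U_at_conj|rewrite !mulgA mulgVK].
Qed.

Lemma bt_rel_refl (R : realType) (K : fieldType) (abs : nonarch_abs R K) n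
  (p : SL K n * apartment R n) : bt_rel abs p p.
Proof.
exists 1%g; split; [exact: normT1|exact: nu1|].
by rewrite mulg1 mulVg; exact: (P_at_subgroup abs p.2).1.
Qed.

Lemma bt_rel_sym (R : realType) (K : fieldType) (abs : nonarch_abs R K) n
  (p q : SL K n * apartment R n) : bt_rel abs p q -> bt_rel abs q p.
Proof.
move=> [m [mN mx mP]]; exists m^-1%g; split; first exact: normTV.
  by rewrite -mx nuK.
have := P_at_conj mN (subgroupV (P_at_subgroup abs p.2) mP).
by rewrite mx !invgM invgK !mulgA mulgV mul1g.
Qed.

Lemma bt_rel_trans (R : realType) (K : fieldType) (abs : nonarch_abs R K) n
  (q p r : SL K n * apartment R n) :
  bt_rel abs p q -> bt_rel abs q r -> bt_rel abs p r.
Proof.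
move=> [m [mN mx mP]] [m' [m'N m'x m'P]]; exists (m' * m)%g; split.
- exact: normTM.
- by rewrite nuM // mx.
- have := P_at_conj (normTV mN) m'P; rewrite -{1}mx nuK // invgK => P'.
  have := subgroupM (P_at_subgroup abs p.2) mP P'.
  by rewrite !mulgA mulgK mulgK.
Qed.

Definition bt_relb (R : realType) (K : fieldType) (abs : nonarch_abs R K)
    (n : nat) : rel (SL K n * apartment R n) :=
  fun p q => `[< bt_rel abs p q >].

Lemma bt_relb_refl (R : realType) (K : fieldType) (abs : nonarch_abs R K) n :
  reflexive (@bt_relb R K abs n).
Proof. by move=> p; apply/asboolP; exact: bt_rel_refl. Qed.

Lemma bt_relb_sym (R : realType) (K : fieldType) (abs : nonarch_abs R K) n :
  symmetric (@bt_relb R K abs n).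
Proof. by move=> p q; apply/asboolP/asboolP => /bt_rel_sym. Qed.

Lemma bt_relb_trans (R : realType) (K : fieldType) (abs : nonarch_abs R K) n :
  transitive (@bt_relb R K abs n).
Proof.
by move=> q p r /asboolP pq /asboolP qr; apply/asboolP/(bt_rel_trans pq qr).
Qed.

Canonical bt_equiv (R : realType) (K : fieldType) (abs : nonarch_abs R K)
    (n : nat) : equiv_rel (SL K n * apartment R n) :=
  EquivRel (@bt_relb R K abs n) (@bt_relb_refl R K abs n)
    (@bt_relb_sym R K abs n) (@bt_relb_trans R K abs n).

Definition building (R : realType) (K : fieldType) (abs : nonarch_abs R K)
    (n : nat) : Type := {eq_quot (bt_equiv abs n)}.

Definition bt_class (R : realType) (K : fieldType) (abs : nonarch_abs R K)
    (n : nat) (g : SL K n) (x : apartment R n) : building abs n :=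
  \pi_({eq_quot (bt_equiv abs n)}) (g, x).

Lemma bt_classP (R : realType) (K : fieldType) (abs : nonarch_abs R K) n
    (g h : SL K n) (x y : apartment R n) :
  bt_class abs g x = bt_class abs h y <-> bt_rel abs (g, x) (h, y).
Proof.
split=> [/eqP|gh]; first by rewrite eqmodE => /asboolP.
by apply/eqP; rewrite eqmodE; apply/asboolP.
Qed.

(* Left multiplication on the first factor of any representative; see
   bt_actE. *)
Definition bt_act (R : realType) (K : fieldType) (abs : nonarch_abs R K)
    (n : nat) (g : SL K n) (b : building abs n) : building abs n :=
  let p := repr (b : {eq_quot (bt_equiv abs n)}) in
  bt_class abs (g * p.1)%g p.2.

Lemma bt_actE (R : realType) (K : fieldType) (abs : nonarch_abs R K) n
    (g h : SL K n) (x : apartment R n) :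
  bt_act g (bt_class abs h x) = bt_class abs (g * h)%g x.
Proof.
rewrite /bt_act; set b : {eq_quot (bt_equiv abs n)} := bt_class abs h x.
have : bt_class abs (repr b).1 (repr b).2 = bt_class abs h x.
  by rewrite /bt_class -surjective_pairing reprK.
move=> /bt_classP[m [mN mx mP]]; apply/bt_classP; exists m; split=> //=.
by rewrite invgM !mulgA mulgVK.
Qed.

Definition apt_point (R : realType) (K : fieldType) (abs : nonarch_abs R K)
    (n : nat) (x : apartment R n) : building abs n :=
  bt_class abs 1%g x.

Definition bt_stab (R : realType) (K : fieldType) (abs : nonarch_abs R K)
    (n : nat) (b : building abs n) : set (SL K n) :=
  [set g | bt_act g b = b].

Definition trop (R : realType) (K : fieldType) (abs : nonarch_abs R K)
    (n : nat) (g : 'M[K]_n) : 'M[\bar R]_n :=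
  map_mx (fun a => (- val_of abs a)%E) g.

(* Matrix-vector product over the max-plus semiring. *)
Definition trop_mulmx (R : realType) (n : nat) (M : 'M[\bar R]_n)
    (x : 'cV[\bar R]_n) : 'cV[\bar R]_n :=
  \col_i \big[maxe/-oo%E]_j (M i j + x j 0%R)%E.

(* Main.v *)
(** Let M be the set of [g] in [SL_n] with [|g i j| <= exp (x i - x j)] for all
    [i], [j]. The ultrametric inequality applied to the Leibniz formula for
    [det g = 1] shows that every row and every column of [g] in M attains one of
    its bounds; hence M is the tropical stabilizer of [x].
    M contains [N_x] and [U_x] and is closed under products, so it contains
    [P_x]. Conversely, an element of M is reduced to a diagonal matrix by
    Gaussian elimination: an attained bound in column [k] gives, after one row
    operation in [U_x], a unit at position [(k, k)], and clearing row and column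
    [k] multiplies by elements of [U_x] on both sides. The resulting diagonal
    matrix has unit entries, hence fixes [x]. *)

Require Import Defs.
From mathcomp Require Import all_boot all_order all_algebra.
From mathcomp Require Import perm boolp sequences exp.
From mathcomp Require Import classical_sets reals constructive_ereal.

Import Order.TTheory GRing.Theory Num.Theory.
Local Open Scope classical_set_scope.
Local Open Scope ring_scope.

(** * Ultrametric estimates, and the passage between [val_of] and [abs] *)

Section NonarchAbs.
Context {R : realType} {K : fieldType} (abs : nonarch_abs R K).

Lemma absv0 : abs 0 = 0.
Proof. exact/absv_eq0. Qed.

Lemma absv_neq0 a : 0 < abs a -> a != 0.
Proof. by apply: contraTneq => ->; rewrite absv0 ltxx. Qed.

Lemma absvN1 : abs (-1) = 1.
Proof.
apply/eqP; rewrite -(@pexpr_eq1 R (abs (-1)) 2) ?absv_ge0 //.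
by rewrite expr2 -absvM mulrNN mulr1 absv1.
Qed.

Lemma absvN a : abs (- a) = abs a.
Proof. by rewrite -mulN1r absvM absvN1 mul1r. Qed.

Lemma absvV a : abs a^-1 = (abs a)^-1.
Proof.
have [->|a0] := eqVneq a 0; first by rewrite invr0 absv0 invr0.
have aa0 : abs a != 0 by rewrite gt_eqF // absv_gt0.
by apply: (mulfI aa0); rewrite -absvM !divff // absv1.
Qed.

Lemma absv_sign (b : bool) : abs ((-1) ^+ b) = 1.
Proof. by case: b; rewrite ?absvN1 ?absv1. Qed.

Lemma absv_prod (I : Type) (r : seq I) (P : pred I) (F : I -> K) :
  abs (\prod_(i <- r | P i) F i) = \prod_(i <- r | P i) abs (F i).
Proof. exact: (big_morph _ (absvM abs) (absv1 abs)). Qed.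

Lemma absvD_le c a b : abs a <= c -> abs b <= c -> abs (a + b) <= c.
Proof. by move=> ac bc; rewrite (le_trans (absv_ultra _ _ _)) // ge_max ac. Qed.

Lemma absvD_lt c a b : abs a < c -> abs b < c -> abs (a + b) < c.
Proof.
by move=> ac bc; rewrite (le_lt_trans (absv_ultra _ _ _)) // gt_max ac.
Qed.

Lemma absv_sum_le c (I : Type) (r : seq I) (P : pred I) (F : I -> K) :
  0 <= c -> (forall i, P i -> abs (F i) <= c) ->
  abs (\sum_(i <- r | P i) F i) <= c.
Proof.
move=> c0 Fc; apply: (big_ind (fun a => abs a <= c)) => //.
  by rewrite absv0.
exact: absvD_le.
Qed.

Lemma absv_sum_lt c (I : Type) (r : seq I) (P : pred I) (F : I -> K) :
  0 < c -> (forall i, P i -> abs (F i) < c) ->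
  abs (\sum_(i <- r | P i) F i) < c.
Proof.
move=> c0 Fc; apply: (big_ind (fun a => abs a < c)) => //.
  by rewrite absv0.
exact: absvD_lt.
Qed.

Lemma expR_le_val (l : R) a : (l%:E <= val_of abs a)%E = (abs a <= expR (- l)).
Proof.
rewrite /val_of; have [->|a0] := eqVneq a 0.
  by rewrite absv0 leey expR_ge0.
by rewrite lee_fin lerNr -[LHS]ler_expR lnK // posrE absv_gt0.
Qed.

Lemma trop_term_le a (r s : R) :
  (- val_of abs a + r%:E <= s%:E)%E = (abs a <= expR (s - r)).
Proof.
rewrite -(opprB r s) -expR_le_val /val_of; case: ifP => [_|_].
  by rewrite leey leNye.
by rewrite -EFinN -EFinD !lee_fin opprK -lerBrDr lerNr opprB.
Qed.

Lemma trop_term_eq a (r s : R) : abs a = expR (s - r) ->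
  (- val_of abs a + r%:E = s%:E)%E.
Proof.
move=> aE; have a0 : a != 0 by rewrite absv_neq0 // aE expR_gt0.
by rewrite /val_of (negPf a0) -EFinN -EFinD opprK aE expRK subrK.
Qed.

(** * Bounded matrices as the tropical stabilizer *)

Section Bounded.
Context {n : nat}.
Implicit Types (x : 'cV[R]_n) (g : 'M[K]_n).

(* Equivalently, [g] maps the ball of radius 1 of the norm
   [max_j exp (- x j) * |c j|] into itself. *)
Definition trop_bounded x g :=
  forall i j, abs (g i j) <= expR (x i 0 - x j 0).

Lemma trop_bounded1 x : trop_bounded x 1%:M.
Proof.
move=> i j; rewrite mxE; have [->|_] := eqVneq i j.
  by rewrite absv1 subrr expR0.
by rewrite absv0 expR_ge0.
Qed.

Lemma trop_boundedD x g h :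
  trop_bounded x g -> trop_bounded x h -> trop_bounded x (g + h).
Proof. by move=> gx hx i j; rewrite mxE absvD_le. Qed.

Lemma trop_boundedM x g h :
  trop_bounded x g -> trop_bounded x h -> trop_bounded x (g *m h).
Proof.
move=> gx hx i j; rewrite mxE absv_sum_le ?expR_ge0 // => k _.
have -> : x i 0 - x j 0 = (x i 0 - x k 0) + (x k 0 - x j 0).
  by rewrite addrA subrK.
by rewrite absvM expRD ler_pM ?absv_ge0.
Qed.

(** Lets the attained bound in each column be deduced from the one in each row. *)
Lemma trop_boundedT x g : trop_bounded x g -> trop_bounded (- x) g^T.
Proof. by move=> gx i j; rewrite !mxE opprK addrC. Qed.

Lemma trop_bounded_delta x (i j : 'I_n) w :
  abs w <= expR (x i 0 - x j 0) -> trop_bounded x (w *: delta_mx i j).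
Proof.
move=> wx k l; rewrite !mxE; case: eqP => [->|_]; last first.
  by rewrite mulr0 absv0 expR_ge0.
by case: eqP => [->|_]; rewrite ?mulr1 ?mulr0 ?absv0 ?expR_ge0.
Qed.

(* Each Leibniz term is bounded by [prod_i exp (x i - x (s i)) = 1]. *)
Lemma absv_det_lt1 x g i : trop_bounded x g ->
  (forall j, abs (g i j) < expR (x i 0 - x j 0)) -> abs (\det g) < 1.
Proof.
move=> gx gi; apply: absv_sum_lt => // s _.
rewrite absvM absv_sign mul1r absv_prod.
have prod1 : \prod_k expR (x k 0 - x (s k) 0) = 1.
  by rewrite -expR_sum sumrB (reindex_inj (@perm_inj _ s)) /= subrr expR0.
rewrite -[ltRHS]prod1 (bigD1 i) //= [ltRHS](bigD1 i) //=.
(* The mixed product is needed because the factors of [g] may vanish, whereas the exponentials are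
   positive. *)
apply: (@le_lt_trans _ _
  (abs (g i (s i)) * \prod_(k | k != i) expR (x k 0 - x (s k) 0))).
  apply: ler_wpM2l; first exact: absv_ge0.
  apply: ler_prod => k _.
  by rewrite absv_ge0 gx.
by rewrite ltr_pM2r // prodr_gt0 // => k _; rewrite expR_gt0.
Qed.

Lemma trop_bounded_row x g i : trop_bounded x g -> \det g = 1 ->
  exists j, abs (g i j) = expR (x i 0 - x j 0).
Proof.
move=> gx g1; apply: contrapT => /forallNP gi.
suff : abs (\det g) < 1 by rewrite g1 absv1 ltxx.
by apply: (absv_det_lt1 x g i) => // j; rewrite lt_neqAle gx andbT; apply/eqP.
Qed.

Lemma trop_bounded_col x g j : trop_bounded x g -> \det g = 1 ->
  exists i, abs (g i j) = expR (x i 0 - x j 0).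
Proof.
move=> /trop_boundedT gx g1.
have [|i] := trop_bounded_row _ _ j gx; first by rewrite det_tr.
by rewrite !mxE opprK addrC; exists i.
Qed.

(** The bounds alone give only [<=] in each coordinate; equality comes from an attained bound in
    each row, hence from the determinant being 1. *)
Lemma trop_fixedP x (g : SL K n) :
  trop_mulmx (trop abs g) (map_mx EFin x) = map_mx EFin x <-> trop_bounded x g.
Proof.
split=> [gx i j|gx].
  rewrite -trop_term_le; have /matrixP/(_ i 0) := gx; rewrite !mxE => <-.
  by rewrite (le_trans _ (le_bigmax _ _ j)) // !mxE.
apply/matrixP => i k; rewrite (ord1 k) !mxE; apply/eqP; rewrite eq_le.
apply/andP; split.
  by apply: bigmax_le => [|j _]; rewrite ?leNye // !mxE trop_term_le.
have [j gij] := trop_bounded_row _ _ i gx (eqP (slmx_det g)).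
by apply: (bigmax_sup j) => //; rewrite !mxE (trop_term_eq _ _ _ gij).
Qed.

(** * Elements of [P_at] are bounded *)

Lemma root_subgroup_bounded x (i j : 'I_n) (u : SL K n) :
  root_subgroup abs i j (- (x i 0 - x j 0)) u -> trop_bounded x u.
Proof.
move=> [w]; rewrite expR_le_val opprK => wx ->.
by apply: trop_boundedD; [exact: trop_bounded1|exact: trop_bounded_delta].
Qed.

Lemma root_subgroupV (i j : 'I_n) (l : R) (u : SL K n) : i != j ->
  root_subgroup abs i j l u -> root_subgroup abs i j l u^-1%g.
Proof.
move=> ij [w wl uE]; exists (- w).
  by rewrite expR_le_val absvN -expR_le_val.
apply: (can_inj (mulKmx (sl_unit u))); rewrite -slmxM mulgV slmx1 uE.
rewrite mulmxDl !mulmxDr !mul1mx mulmx1 -scalemxAl -scalemxAr mul_delta_mx_cond.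
by rewrite eq_sym (negPf ij) mulr0n !scaler0 addr0 scaleNr addrNK.
Qed.

Lemma U_at_bounded x (u : SL K n) : U_at abs x u -> trop_bounded x u.
Proof.
(* Boundedness is not yet known to pass to inverses; asking it of both makes [H] a subgroup. *)
pose H := [set g : SL K n | trop_bounded x g /\ trop_bounded x (g^-1)%g].
move=> uU; suff [] : H u by [].
apply: uU; split.
  split; first by split; rewrite ?invg1; exact: trop_bounded1.
  move=> g h [gx g'x] [hx h'x].
  by split; rewrite ?invgM ?invgK; exact: trop_boundedM.
move=> g [i [j [ij gij]]].
by split; apply: (@root_subgroup_bounded x i j) => //; exact: root_subgroupV.
Qed.

(** Fixing [x] means [x (s i) = x i - v (m (s i) i)], so every nonzero entry attains its bound. *)
Lemma N_at_bounded x (m : SL K n) : N_at abs x m -> trop_bounded x m.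
Proof.
move=> [/(normT_monomial abs)[s ms] mx k i].
have := ms i k; case: (eqVneq k (s i)) => [-> m0|_ /negbFE/eqP->]; last first.
  by rewrite absv0 expR_ge0.
have /colP/(_ (s i)) := mx; rewrite (nuE abs _ _ ms) => <-.
rewrite addrAC subrr add0r.
by rewrite /val_of (negPf m0) /= opprK lnK ?posrE ?absv_gt0.
Qed.

Lemma P_at_bounded x (g : SL K n) : P_at abs x g -> trop_bounded x g.
Proof.
move=> [m mN [u uU <-]].
by apply: trop_boundedM; [exact: N_at_bounded|exact: U_at_bounded].
Qed.

(** * Elementary, unipotent and diagonal elements of [P_at] *)

Lemma det_elementary (i j : 'I_n) (w : K) : i != j ->
  \det (1%:M + w *: delta_mx i j) = 1.
Proof.
move=> ij.
(* The identity with row [i] replaced by row [j]: two equal rows, so determinant 0. *)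
pose B := \matrix_(k < n) row (if k == i then j else k) (1%:M : 'M[K]_n).
have liftF k : (lift i k == i) = false.
  by rewrite eq_sym (negPf (neq_lift _ _)).
rewrite (@determinant_multilinear _ _ _ 1%:M B i 1 w).
- rewrite det1 (determinant_alternate ij) ?mulr0 ?addr0 ?mulr1 // => k.
  have ji : (j == i) = false by rewrite eq_sym (negPf ij).
  by rewrite !mxE eqxx ji.
- by apply/rowP => k; rewrite !mxE !eqxx !mul1r (eq_sym j).
- by apply/matrixP => k l; rewrite !mxE liftF mulr0 addr0.
- by apply/matrixP => k l; rewrite !mxE !liftF mulr0 addr0.
Qed.

Lemma U_at_elementary x (i j : 'I_n) (w : K) : i != j ->
  abs w <= expR (x i 0 - x j 0) ->
  exists2 u : SL K n, U_at abs x u & slmx u = 1%:M + w *: delta_mx i j.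
Proof.
move=> ij wx; have d1 := introT eqP (det_elementary i j w ij).
exists (MkSL d1) => //; move=> H [_]; apply; exists i, j; split=> //.
by exists w => //; rewrite expR_le_val opprK.
Qed.

(* Such matrices [1 + A] form an abelian group isomorphic to the additive group
   of the [A]s: the unipotent radical of a maximal parabolic subgroup. *)
Lemma U_at_unipotent x (S : pred 'I_n) (A : 'M[K]_n) :
  trop_bounded x A -> (forall i j, ~~ (S i && ~~ S j) -> A i j = 0) ->
  exists2 u : SL K n, U_at abs x u & slmx u = 1%:M + A.
Proof.
move=> Ax AS.
pose Q (B : 'M[K]_n) := (forall i j, ~~ (S i && ~~ S j) -> B i j = 0) /\
  exists2 u : SL K n, U_at abs x u & slmx u = 1%:M + B.
have US := U_at_subgroup abs x.
have Q0 : Q 0.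
  split; first by move=> i j _; rewrite mxE.
  by exists 1%g; [exact: US.1|rewrite addr0].
have QD B C : Q B -> Q C -> Q (B + C).
  move=> [BS [u uU uE]] [CS [v vU vE]]; split.
    by move=> i j ij; rewrite mxE BS // CS // addr0.
  exists (u * v)%g; first exact: (subgroupM US uU vU).
  (* A nonzero [B i k] forces [k] outside [S], a nonzero [C k j] forces [k] into [S]. *)
  have BC0 : B *m C = 0.
    apply/matrixP => i j; rewrite !mxE big1 // => k _.
    have [Sk|Sk] := boolP (S k); first by rewrite BS ?mul0r // Sk andbF.
    by rewrite CS ?mulr0 // (negPf Sk).
  rewrite slmxM uE vE mulmxDl !mulmxDr !mul1mx mulmx1 BC0 addr0 -addrA.
  by rewrite (addrC C).
suff [] : Q A by [].
rewrite [A]matrix_sum_delta; apply: (big_ind Q) => // i _.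
apply: (big_ind Q) => // j _.
have [/andP[Si Sj]|ij] := boolP (S i && ~~ S j); last by rewrite AS // scale0r.
split.
  move=> k l kl; rewrite !mxE; case: (eqVneq k i) => [ki|]; last first.
    by rewrite mulr0.
  case: (eqVneq l j) => [lj|]; last by rewrite mulr0.
  by rewrite ki lj Si Sj in kl.
by apply: U_at_elementary => //; apply: contraNneq Sj => <-.
Qed.

Lemma U_at_P x (u : SL K n) : U_at abs x u -> P_at abs x u.
Proof.
move=> uU; exists 1%g; last by exists u; rewrite ?mul1g.
exact: (N_at_subgroup abs x).1.
Qed.

Lemma torus_normT (t : SL K n) : torus t -> normT t.
Proof.
move=> tT; have comm (t' : SL K n) : torus t' -> (t * t' * t^-1)%g = t'.
  move=> t'T; suff -> : (t * t' = t' * t)%g by rewrite mulgK.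
  apply/val_inj => /=.
  have /diag_mxP[d ->] := tT; have /diag_mxP[d' ->] := t'T.
  exact: diag_mx_comm.
apply/seteqP; split=> [_ [t' t'T <-]|t' t'T]; first by rewrite comm.
by exists t'; rewrite ?comm.
Qed.

Lemma torus_P_at x (t : SL K n) : torus t -> (forall i, abs (t i i) = 1) ->
  P_at abs x t.
Proof.
move=> tT t1; exists t; last first.
  by exists 1%g; rewrite ?mulg1 //; exact: (U_at_subgroup abs x).1.
split; first exact: torus_normT.
rewrite nu_torus // big1 ?addr0 // => i _.
rewrite /val_of; case: ifP => _ /=; first by rewrite oppr0 scale0r.
by rewrite t1 ln1 !oppr0 scale0r.
Qed.

(** * Gaussian elimination by elements of [U_at] *)

Lemma mul_add1_col (A g : 'M[K]_n) (k i l : 'I_n) :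
  (forall j, j != k -> A i j = 0) ->
  ((1%:M + A) *m g) i l = g i l + A i k * g k l.
Proof.
move=> Ak; rewrite mulmxDl mul1mx !mxE (bigD1 k) //= big1 ?addr0 // => j jk.
by rewrite Ak ?mul0r.
Qed.

Lemma mul_add1_row (B g : 'M[K]_n) (k i l : 'I_n) :
  (forall j, j != k -> B j l = 0) ->
  (g *m (1%:M + B)) i l = g i l + g i k * B k l.
Proof.
move=> Bk; rewrite mulmxDr mulmx1 !mxE (bigD1 k) //= big1 ?addr0 // => j jk.
by rewrite Bk ?mulr0.
Qed.

(** As the pivot is a unit, the multipliers [g i k / g k k] and [g k j / g k k] inherit the bounds
    of [g]. What remains is the Schur complement of the pivot. *)
Lemma clear_cross x (g : SL K n) (k : 'I_n) :
  trop_bounded x g -> abs (g k k) = 1 ->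
  exists u v : SL K n, [/\ U_at abs x u /\ U_at abs x v,
    (u * g * v)%g k k = g k k,
    forall i, i != k -> (u * g * v)%g i k = 0,
    forall j, j != k -> (u * g * v)%g k j = 0 &
    forall i j, i != k -> j != k ->
      (u * g * v)%g i j = g i j - g i k * g k j / g k k].
Proof.
move=> gx gk; have gk0 : g k k != 0 by rewrite absv_neq0 // gk.
pose A : 'M[K]_n := \matrix_(i, j)
  if (i != k) && (j == k) then - (g i k / g k k) else 0.
pose B : 'M[K]_n := \matrix_(i, j)
  if (i == k) && (j != k) then - (g k j / g k k) else 0.
have [||u uU uE] := U_at_unipotent x (predC1 k) A.
- move=> i j; rewrite mxE; case: ifP => [/andP[_ /eqP->]|_].
    by rewrite absvN absvM absvV gk invr1 mulr1 gx.
  by rewrite absv0 expR_ge0.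
- by move=> i j; rewrite mxE /= negbK => /negPf->.
have [||v vU vE] := U_at_unipotent x (pred1 k) B.
- move=> i j; rewrite mxE; case: ifP => [/andP[/eqP-> _]|_].
    by rewrite absvN absvM absvV gk invr1 mulr1 gx.
  by rewrite absv0 expR_ge0.
- by move=> i j; rewrite mxE /= => /negPf->.
have ugE i j : (u * g)%g i j = g i j + A i k * g k j.
  rewrite slmxM uE (@mul_add1_col _ _ k) // => l lk.
  by rewrite mxE (negPf lk) andbF.
have E i j : (u * g * v)%g i j = (u * g)%g i j + (u * g)%g i k * B k j.
  by rewrite slmxM vE (@mul_add1_row _ _ k) // => l lk; rewrite mxE (negPf lk).
exists u, v; split=> // [|i ik|j jk|i j ik jk]; rewrite E !ugE !mxE !eqxx /=.
- by rewrite mulr0 mul0r !addr0.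
- by rewrite ik mulr0 addr0 mulNr divfK // subrr.
- by rewrite jk !mul0r !addr0 mulrN mulrCA divff // mulr1 subrr.
- by rewrite ik jk !mulNr divfK // subrr mul0r addr0 mulrAC.
Qed.

(* The index set splits as [{0, ..., k - 1}] and its complement, and [g] is
   block diagonal, with a diagonal first block. *)
Definition diag_upto (k : nat) g :=
  forall i j : 'I_n, i != j -> (i < k)%N || (j < k)%N -> g i j = 0.

(* When [g k k] is too small, adding to row [k] a multiple of the row [i] in
   which column [k] attains its bound makes it a unit. *)
Lemma unit_pivot x (g : SL K n) (k : 'I_n) :
  trop_bounded x g -> diag_upto k g ->
  exists u : SL K n,
    [/\ U_at abs x u, diag_upto k (u * g)%g & abs ((u * g)%g k k) = 1].
Proof.
move=> gx gD; have := gx k k.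
rewrite subrr expR0 le_eqVlt => /orP[/eqP gk1|gk1].
  exists 1%g; rewrite mul1g; split=> //; exact: (U_at_subgroup abs x).1.
have [i gi] := trop_bounded_col _ _ k gx (eqP (slmx_det g)).
have gi0 : g i k != 0 by rewrite absv_neq0 // gi expR_gt0.
have ik : k != i.
  by apply: contraTneq gk1 => ki; rewrite {1}ki gi -ki subrr expR0 ltxx.
have ki : (k <= i)%N.
  by rewrite leqNgt; apply: contraNN gi0 => ik'; rewrite gD ?ik' // eq_sym.
(* Since [g i k] attains its bound, its inverse meets the bound at position [(k, i)]. *)
have [|u uU uE] := U_at_elementary x k i (g i k)^-1 ik.
  by rewrite absvV gi -expRN opprB.
have ugE p q : (u * g)%g p q = g p q + (g i k)^-1 * (p == k)%:R * g i q.
  rewrite slmxM uE (@mul_add1_col _ _ i) ?mxE ?eqxx ?andbT // => l li.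
  by rewrite !mxE (negPf li) andbF mulr0.
exists u; split=> // [p q pq pqk|].
  rewrite ugE gD // add0r; case: (eqVneq p k) pq pqk => [->|_ _ _]; last first.
    by rewrite mulr0 mul0r.
  rewrite ltnn /= => kq qk; rewrite (gD i q) ?mulr0 ?qk ?orbT //.
  by apply: contraTneq qk => <-; rewrite -leqNgt.
rewrite ugE eqxx mulr1 mulVf //; apply/eqP.
(* The new pivot is [g k k + 1] with [abs (g k k) < 1]; were it also of absolute value below 1, so
   would be the difference 1. *)
rewrite eq_le absvD_le ?absv1 ?(ltW gk1) //=.
rewrite leNgt; apply/negP => ugk1; suff : abs 1 < 1 by rewrite absv1 ltxx.
by rewrite -[1](addKr (g k k)) absvD_lt ?absvN.
Qed.

(** Induction on the number [d] of indices still to be cleared. *)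
Lemma diag_upto_P_at x (d k : nat) (g : SL K n) : (k + d)%N = n ->
  trop_bounded x g -> diag_upto k g -> P_at abs x g.
Proof.
have PS := P_at_subgroup abs x.
elim: d k g => [|d IHd] k g.
  rewrite addn0 => -> gx gD; apply: torus_P_at => [|j].
    by apply/is_diag_mxP => i j ij; rewrite gD ?ltn_ord.
  (* The attained bound in column [j] sits at a nonzero entry, hence on the diagonal, where the
     bound is 1. *)
  have [i gij] := trop_bounded_col _ _ j gx (eqP (slmx_det g)).
  suff ij : i = j by move: gij; rewrite ij subrr expR0.
  have : g i j != 0 by rewrite absv_neq0 // gij expR_gt0.
  by apply: contraNeq => ij; rewrite gD ?ltn_ord.
rewrite addnS => kn gx gD.
have kn' : (k < n)%N by rewrite -kn ltnS leq_addr.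
pose k' := Ordinal kn'.
have [u [uU ugD ugk]] := unit_pivot x g k' gx gD.
have ugx := trop_boundedM _ _ _ (U_at_bounded _ _ uU) gx.
have [v [w [[vU wU] hkk colk rowk restk]]] :=
  clear_cross x (u * g)%g k' ugx ugk.
set h := (v * (u * g) * w)%g in hkk colk rowk restk.
suff hP : P_at abs x h.
  have -> : g = (u^-1 * (v^-1 * h * w^-1))%g.
    by rewrite /h !mulgA mulgK mulgVK mulVg mul1g.
  have PV y : U_at abs x y -> P_at abs x y^-1%g.
    by move=> /U_at_P; exact: (subgroupV PS).
  have vhwP := subgroupM PS (subgroupM PS (PV _ vU) hP) (PV _ wU).
  exact: (subgroupM PS (PV _ uU) vhwP).
have hx : trop_bounded x h.
  apply: trop_boundedM; last exact: U_at_bounded.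
  by apply: trop_boundedM => //; exact: U_at_bounded.
have hD : diag_upto k.+1 h.
  move=> i j ij; rewrite !ltnS => ijk.
  have [ik|ik] := eqVneq i k'; first by rewrite ik rowk // -ik eq_sym.
  have [jk|jk] := eqVneq j k'; first by rewrite jk colk.
  have {}ijk : (i < k)%N || (j < k)%N.
    move: ik jk ijk; rewrite -[i == k']val_eqE -[j == k']val_eqE /=.
    by rewrite (leq_eqVlt i) (leq_eqVlt j) => /negPf-> /negPf->.
  (* Row [i] or column [j] was already cleared, so the Schur correction has a zero factor. *)
  rewrite restk // ugD // sub0r; apply/eqP.
  rewrite oppr_eq0 !mulf_eq0; case/orP: ijk => [ik'|jk'].
    by rewrite (ugD i k') ?eqxx // ik'.
  by rewrite (ugD k' j) ?eqxx ?orbT // ?jk' ?orbT // eq_sym.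
by apply: (IHd k.+1); rewrite ?addSn.
Qed.

(** * Stabilizers in the building *)

Lemma P_atE x : P_at abs x = [set g : SL K n | trop_bounded x g].
Proof.
apply/seteqP; split=> g; first exact: P_at_bounded.
by move=> gx; apply: (diag_upto_P_at x n 0) => // i j _; rewrite !ltn0.
Qed.

(** If [(g, x)] and [(1, x)] are related through [m], then [m] fixes [x] and lies in [P_at], hence
    so does [g = m * (g^-1 * m)^-1]. *)
Lemma bt_stabE (x : apartment R n) : bt_stab (apt_point abs x) = P_at abs x.
Proof.
have PS := P_at_subgroup abs x.
apply/seteqP; split=> g; rewrite /bt_stab /= /apt_point bt_actE mulg1.
  move=> /bt_classP[m [/= mN mx]]; rewrite mulg1 => gmP.
  have mP : P_at abs x m.
    exists m => //; exists 1%g; last by rewrite mulg1.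
    exact: (U_at_subgroup abs x).1.
  have := subgroupM PS mP (subgroupV PS gmP).
  by rewrite invgM invgK mulgA mulgV mul1g.
move=> gP; apply/bt_classP; exists 1%g; split; [exact: normT1|exact: nu1|].
by rewrite /= !mulg1; exact: (subgroupV PS).
Qed.

End Bounded.
End NonarchAbs.

Theorem theorem1p2 (R : realType) (K : fieldType) (abs : nonarch_abs R K)
    (n : nat) (hn : (2 <= n)%N) (x : apartment R n) :
  bt_stab (apt_point abs x) =
  [set g : SL K n |
     trop_mulmx (trop abs g) (map_mx EFin x) = map_mx EFin x].
Proof.
by rewrite bt_stabE P_atE; apply/seteqP; split=> g /trop_fixedP.
Qed.
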